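(* There exists an $O(\log(mn))$-competitive algorithm for random-order non-metric facility location: there is an absolute constant $C$ such that for every instance, the algorithm's expected cost is at most $C\log(mn)$ times the optimal cost.
   Context: Non-metric facility location: there are $m$ facilities with opening costs $c_i\ge0$ and $n$ clients, with arbitrary nonnegative connection costs $d_{ie}$ (no triangle inequality assumed). A solution opens a set of facilities and connects each client $e$ to an open facility $i$; its cost is the total opening cost plus $\sum_e d_{i(e)e}$. In the random-order online model, the instance is fixed by an adversary, the facility opening costs are known, and the clients arrive in a uniformly random order; when a client arrives, the algorithm learns its connection costs, may irrevocably open facilities, and must connect the client to an open facility, paying the connection cost. The expected cost, over the random order and the algorithm's randomness, is compared with the offline optimum.
   Formalization: The bound is stated for mn at least 2: for m = n = 1 the factor log(mn) is 0 and the claim fails whenever the optimum is positive, and for mn = 0 the logarithm is undefined. *)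

(* Defs.v *)
From HB Require Import structures.
From mathcomp Require Import all_boot all_order all_algebra all_fingroup.
From mathcomp Require Import classical_sets reals exp.

Set Implicit Arguments.
Unset Strict Implicit.
Unset Printing Implicit Defensive.

Import Order.TTheory GRing.Theory Num.Theory.
Local Open Scope ring_scope.

Section OfflineProblem.
Context {R : realType} {m n : nat}.

(* (F, phi): F is the set of open facilities, client e is served by phi e. *)
Definition solution := ({set 'I_m} * {ffun 'I_n -> 'I_m})%type.

Definition feasible (s : solution) : bool := [forall e, s.2 e \in s.1].

(* c i is the opening cost of facility i, d i e the cost of connecting client
   e to facility i. *)
Definition cost (c : 'I_m -> R) (d : 'I_m -> 'I_n -> R) (s : solution) : R :=
  \sum_(i in s.1) c i + \sum_e d (s.2 e) e.

(* The infimum is over a finite set, nonempty as soon as 0 < m, hence is then a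
   minimum. *)
Definition opt (c : 'I_m -> R) (d : 'I_m -> 'I_n -> R) : R :=
  inf (cost c d @` [set s | feasible s])%classic.

End OfflineProblem.

Section OnlineAlgorithm.
Context {R : realType} {m : nat}.

(* What an arriving client reveals: its connection cost to each facility, but
   neither its name nor the number of clients still to come. *)
Definition request := 'I_m -> R.

(* (F, i): open the facilities of F, then connect the client to i. *)
Definition action := ({set 'I_m} * 'I_m)%type.

(* Past requests and the actions taken on them, oldest first. *)
Definition history := seq (request * action).

Definition opened (h : history) : {set 'I_m} := \bigcup_(x <- h) x.2.1.

(* A randomized online algorithm in behavioural form: p h r a is the
   probability of answering a to the request r after the history h.  As h
   contains all past actions, this loses no generality over algorithms which
   keep a private random seed. *)
Definition policy := history -> request -> action -> R.

Definition valid_policy (p : policy) : Prop :=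
  forall (h : history) (r : request),
    [/\ forall a, 0 <= p h r a,
        \sum_a p h r a = 1
      & forall a : action, a.2 \notin opened h :|: a.1 -> p h r a = 0].

End OnlineAlgorithm.
Arguments request : clear implicits.
Arguments action : clear implicits.
Arguments history : clear implicits.
Arguments policy : clear implicits.

Section RandomOrder.
Context {R : realType} {m n : nat}.
Variables (p : policy R m) (c : 'I_m -> R) (d : 'I_m -> 'I_n -> R).

(* In this section s t is the client arriving at time t, and a t the action
   taken at time t. *)

Definition history_before (s : 'S_n) (a : {ffun 'I_n -> action m}) (t : 'I_n) :
    history R m :=
  [seq (d^~ (s j), a j) | j : 'I_n <- enum 'I_n & (j < t)%N].

Definition run_prob (s : 'S_n) (a : {ffun 'I_n -> action m}) : R :=
  \prod_(t < n) p (history_before s a t) (d^~ (s t)) (a t).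

Definition run_solution (s : 'S_n) (a : {ffun 'I_n -> action m}) :
    @solution m n :=
  (\bigcup_(t < n) (a t).1, [ffun e => (a ((s^-1)%g e)).2]).

(* The arrival order is uniform among the n! permutations of the clients. *)
Definition expected_cost : R :=
  (n`!%:R)^-1 *
    \sum_(s : 'S_n) \sum_(a : {ffun 'I_n -> action m})
      run_prob s a * cost c d (run_solution s a).

End RandomOrder.

(* Main.v *)
(** A learn-or-cover algorithm. The residual of a client is the least cost of
    serving it given the open facilities; the algorithm pays it, and moreover opens
    every facility independently with a probability proportional to its weight
    over its cost, for at most the same amount in expectation. Weights are
    exponentials of scores. A facility is near a client if its connection cost
    is at most half the residual. If the near facilities carry little
    weight per unit of cost, their scores are raised and the relative entropy from an
    optimal solution to the weights decreases; otherwise the sample probably hits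
    a near facility of a random future client, because the order is random,
    and the logarithm of the total future residual decreases. Hence a
    potential of initial value O(log (mn)) times the optimum pays for all steps.
    The optimum is guessed by doubling, and the number of clients by squaring, so
    that the logarithms of the successive horizons form a geometric series. *)

Require Import Defs.
From mathcomp Require Import all_boot all_order all_algebra all_fingroup.
From mathcomp Require Import classical_sets reals sequences exp.
From mathcomp Require Import zify ring lra.

Set Implicit Arguments.
Unset Strict Implicit.
Unset Printing Implicit Defensive.

Import Order.TTheory GRing.Theory Num.Theory.
Local Open Scope ring_scope.

(** * Expected cost in random order, bounded by a supermartingale in the set of clients still to
    come *)

Section RandomOrderSupermartingale.
Context {R : realType} {m n : nat}.
Variables (p : policy R m) (c : 'I_m -> R) (d : 'I_m -> 'I_n -> R).
Hypotheses (c_ge0 : forall i, 0 <= c i) (d_ge0 : forall i e, 0 <= d i e).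
Hypothesis (p_valid : valid_policy p).

Let event := ('I_n * Defs.action m)%type.
Let record (x : event) : request R m * Defs.action m := (d^~ x.1, x.2).

Definition step_cost (F : {set 'I_m}) (x : event) : R :=
  \sum_(i in x.2.1 :\: F) c i + d x.2.2 x.1.

Fixpoint path_prob (h : history R m) (w : seq event) : R :=
  if w is x :: w' then p h (d^~ x.1) x.2 * path_prob (rcons h (record x)) w'
  else 1.

Fixpoint path_cost (h : history R m) (w : seq event) : R :=
  if w is x :: w' then step_cost (opened h) x + path_cost (rcons h (record x)) w'
  else 0.

Lemma opened_rcons (h : history R m) x : opened (rcons h x) = opened h :|: x.2.1.
Proof. by rewrite /opened -cats1 big_cat /= big_seq1. Qed.

Lemma path_prob_ge0 h w : 0 <= path_prob h w.
Proof.
elim: w h => [|x w IH] h //=; rewrite mulr_ge0 //.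
by have [+ _ _] := p_valid h (d^~ x.1); apply.
Qed.

Lemma path_cost_ge0 h w : 0 <= path_cost h w.
Proof.
by elim: w h => [|x w IH] h //=; rewrite addr_ge0 // /step_cost addr_ge0 // sumr_ge0.
Qed.

Lemma big_tuple_cons (T : finType) k (f : seq T -> R) :
  \sum_(w : k.+1.-tuple T) f w = \sum_x \sum_(w : k.-tuple T) f (x :: w).
Proof.
rewrite pair_big /=.
rewrite (reindex (fun xw : T * k.-tuple T => cons_tuple xw.1 xw.2)) //=.
exists (fun w : k.+1.-tuple T => (thead w, behead_tuple w)) => [[x w] _|w _] /=.
  by congr pair; apply/val_inj.
by case/tupleP: w => x w; apply/val_inj.
Qed.

(** At length [#|U|] such a path is an arrival order of [U] together with the actions taken; unlike
    permutations, paths allow induction on the first event. *)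
Definition injective_path (U : {set 'I_n}) (w : seq event) :=
  uniq (unzip1 w) && all (mem U) (unzip1 w).

Lemma injective_path_cons U x w :
  injective_path U (x :: w) = (x.1 \in U) && injective_path (U :\ x.1) w.
Proof.
have allD1 y s : all (mem (U :\ y)) s = (y \notin s) && all (mem U) s.
  elim: s => //= z s ->; rewrite in_cons negb_or !inE eq_sym.
  by case: (_ == _); case: (_ \in s); case: (_ \in U).
rewrite /injective_path /= allD1.
by case: (_ \in unzip1 w); case: (_ \in U); case: (uniq _).
Qed.

(** Given the history, the next client is uniform in [U], so [W_step] is one supermartingale step.
    The sum is not normalised: [U] has [k!] orders. The induction on [k] needs [acc], the cost
    already paid. *)
Lemma path_supermartingale (W : history R m -> {set 'I_n} -> R) :
    (forall h (U : {set 'I_n}), (#|U| + size h)%N = n -> (0 < #|U|)%N ->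
       \sum_(e in U) \sum_a p h (d^~ e) a *
         (step_cost (opened h) (e, a) + W (rcons h (d^~ e, a)) (U :\ e))
       <= #|U|%:R * W h U) ->
    (forall h, size h = n -> 0 <= W h finset.set0) ->
  forall k h (U : {set 'I_n}) acc, #|U| = k -> (k + size h)%N = n ->
  \sum_(w : k.-tuple event | injective_path U w)
    path_prob h w * (acc + path_cost h w) <= k`!%:R * (acc + W h U).
Proof.
move=> W_step W_end; elim=> [|k IH] h U acc Uk kh.
  move/eqP: Uk; rewrite cards_eq0 => /eqP ->.
  rewrite big_mkcond (big_pred1 [tuple]) => [|w]; last first.
    by case: w => -[] //= ?; apply/esym/eqP/val_inj.
  by rewrite fact0 /= mul1r addr0 mul1r lerDl W_end.
rewrite big_mkcond /= (big_tuple_cons k (fun w => if injective_path U w then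
   path_prob h w * (acc + path_cost h w) else 0)) /=.
apply: (@le_trans _ _ (\sum_(e in U) \sum_a p h (d^~ e) a *
   (k`!%:R * (acc + step_cost (opened h) (e, a) + W (rcons h (d^~ e, a)) (U :\ e))))).
  rewrite [leRHS]pair_big_dep /= [leRHS]big_mkcond.
apply: ler_sum => -[e a] _ /=.
  rewrite ?andbT; case: ifP => eU; last first.
    by rewrite big1 // => w _; rewrite injective_path_cons eU.
  have /IH-/(_ (rcons h (d^~ e, a)) (acc + step_cost (opened h) (e, a))) : #|U :\ e| = k.
    by have := cardsD1 e U; rewrite eU Uk => -[].
  rewrite size_rcons addnS => /(_ kh) {}IH.
  have [/(_ a) p_ge0 _ _] := p_valid h (d^~ e).
  apply: le_trans (ler_wpM2l p_ge0 IH); rewrite big_distrr /= big_mkcond /=.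
  rewrite [leRHS]big_mkcond /=; apply: ler_sum => w _; rewrite injective_path_cons /= eU /=.
  by case: ifP => // _; rewrite /record /= addrA mulrA.
have -> : \sum_(e in U) \sum_a p h (d^~ e) a *
   (k`!%:R * (acc + step_cost (opened h) (e, a) + W (rcons h (d^~ e, a)) (U :\ e)))
  = k`!%:R * (#|U|%:R * acc + \sum_(e in U) \sum_a p h (d^~ e) a *
         (step_cost (opened h) (e, a) + W (rcons h (d^~ e, a)) (U :\ e))).
  rewrite [#|U|%:R * acc]mulr_natl -sumr_const -big_split /= big_distrr /=; apply: eq_bigr => e _.
  have [_ p1 _] := p_valid h (d^~ e).
  rewrite -[X in X + _]mul1r -p1 big_distrl /= -big_split /= big_distrr /=.
  by apply: eq_bigr => a _; ring.
rewrite factS natrM -mulrA mulrCA ler_wpM2l ?ler0n //.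
by rewrite -Uk mulrDr lerD2l W_step // ?Uk.
Qed.

Lemma path_probE k h (w : k.-tuple event) : path_prob h w =
  \prod_(t < k) p (h ++ take t (map record w)) (d^~ (tnth w t).1) (tnth w t).2.
Proof.
elim: k h w => [|k IH] h w; first by rewrite tuple0 big_ord0.
case/tupleP: w => x w; rewrite big_ord_recl /= cats0 tnth0 IH; congr (_ * _).
by apply: eq_bigr => t _; rewrite tnthS cat_rcons.
Qed.

Lemma filter_enum_ord_ltn (t : nat) : [seq j : 'I_n <- enum 'I_n | (j < t)%N] = take t (enum 'I_n).
Proof.
apply: (inj_map val_inj); rewrite map_take val_enum_ord take_iota.
rewrite -(filter_map val (fun j => (j < t)%N)) val_enum_ord.
apply: (irr_sorted_eq ltn_trans ltnn); rewrite ?iota_ltn_sorted //.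
  by rewrite sorted_filter ?iota_ltn_sorted //; apply: ltn_trans.
by move=> j; rewrite mem_filter !mem_iota /= !add0n leq_min.
Qed.

Lemma sum_setU (A B : {set 'I_m}) :
  \sum_(i in A :|: B) c i = \sum_(i in A) c i + \sum_(i in B :\: A) c i.
Proof.
by rewrite (big_setID A) /= finset.setUK finset.setDUl finset.setDv finset.set0U.
Qed.

Lemma path_cost_ge h w :
  \sum_(i in \bigcup_(x <- w) x.2.1) c i + \sum_(x <- w) d x.2.2 x.1
  <= \sum_(i in opened h) c i + path_cost h w.
Proof.
(* Once the facilities of [h] are counted too, each event adds the same amount to both sides. *)
suff H : \sum_(i in opened h :|: \bigcup_(x <- w) x.2.1) c i + \sum_(x <- w) d x.2.2 x.1
  <= \sum_(i in opened h) c i + path_cost h w.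
  apply: le_trans H; rewrite lerD2r finset.setUC sum_setU lerDl.
  by rewrite sumr_ge0.
elim: w h => [|x w IH] h /=; first by rewrite !big_nil finset.setU0 addr0.
rewrite !big_cons finset.setUA; move: (IH (rcons h (record x))).
by rewrite opened_rcons !sum_setU /= /step_cost; lra.
Qed.

Lemma expected_cost_le (W : history R m -> {set 'I_n} -> R) :
    (forall h (U : {set 'I_n}), (#|U| + size h)%N = n -> (0 < #|U|)%N ->
       \sum_(e in U) \sum_a p h (d^~ e) a *
         (step_cost (opened h) (e, a) + W (rcons h (d^~ e, a)) (U :\ e))
       <= #|U|%:R * W h U) ->
    (forall h, size h = n -> 0 <= W h finset.set0) ->
  expected_cost p c d <= W [::] [set: 'I_n].
Proof.
move=> W_step W_end.
have := @path_supermartingale W W_step W_end n [::] [set: 'I_n] 0.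
rewrite cardsT card_ord addn0 => /(_ erefl erefl); rewrite add0r => H.
rewrite /expected_cost ler_pdivrMl ?ltr0n ?fact_gt0 //; apply: le_trans H.
rewrite pair_big /=.
(* Runs embed injectively into injective paths, and the remaining paths contribute nonnegative
   terms. *)
pose f (sa : 'S_n * {ffun 'I_n -> Defs.action m}) : n.-tuple event :=
  [tuple (sa.1 t, sa.2 t) | t < n].
have f_inj : injective f.
  move=> [s a] [s' a'] /eqP; rewrite eqEtuple => /forallP /= E; congr pair.
    by apply/permP => t; have /eqP := E t; rewrite !tnth_mktuple /= => -[].
  by apply/ffunP => t; have /eqP := E t; rewrite !tnth_mktuple /= => -[].
pose G (w : seq event) := path_prob [::] w * (0 + path_cost [::] w).
apply: (@le_trans _ _ (\sum_sa G (f sa))); last first.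
  rewrite -(big_imset (fun w : n.-tuple event => G w) (in2W f_inj)) /= big_mkcond /=.
  rewrite [leRHS]big_mkcond /=; apply: ler_sum => w _.
  have [/imsetP[[s a] _ ->]|_] := boolP (w \in _).
    rewrite ifT ?/G //; apply/andP; split; last by apply/allP => t; rewrite !inE.
    rewrite /unzip1 -map_comp map_inj_uniq ?enum_uniq // => t t' /=.
    exact: perm_inj.
  by case: ifP => // _; rewrite mulr_ge0 ?path_prob_ge0 // add0r path_cost_ge0.
rewrite /G; apply: ler_sum => -[s a] _.
have -> : run_prob p d s a = path_prob [::] (f (s, a)).
  rewrite path_probE; apply: eq_bigr => t _; rewrite !tnth_mktuple /=; congr p.
  by rewrite /history_before filter_enum_ord_ltn -map_comp map_take.
rewrite ler_wpM2l ?path_prob_ge0 //.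
have := path_cost_ge [::] (f (s, a)); rewrite /opened big_nil finset.big_set0.
apply: le_trans; rewrite /cost /= !big_map -!enumT !big_enum /= lerD2l.
rewrite (reindex_inj (@perm_inj _ s)) /=.
by apply: ler_sum => t _; rewrite ffunE permK.
Qed.

End RandomOrderSupermartingale.

(** * Independent sampling and elementary exponential bounds *)

Section IndependentSampling.
Context {R : realType} {I : finType}.

Definition sample_prob (pi : I -> R) (A : {set I}) : R :=
  \prod_i (if i \in A then pi i else 1 - pi i).

Lemma sample_prob_ge0 pi A : (forall i, 0 <= pi i <= 1) -> 0 <= sample_prob pi A.
Proof.
move=> pi01; apply: prodr_ge0 => i _; have /andP[pi_ge0 pi_le1] := pi01 i.
by case: ifP => _ //; rewrite subr_ge0.
Qed.

Lemma sum_sample_prob pi : \sum_A sample_prob pi A = 1.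
Proof. by rewrite -bigA_distr big1 // => i _ /=; rewrite addrC subrK. Qed.

Lemma sample_prob_disjoint pi (N : {pred I}) :
  \sum_(A : {set I} | [disjoint A & N]) sample_prob pi A = \prod_(i in N) (1 - pi i).
Proof.
(* Putting 0 for [pi] on [N] kills exactly the sets meeting [N] when the product is expanded. *)
transitivity (\prod_i ((if i \in N then 0 else pi i) + (1 - pi i))).
  rewrite bigA_distr big_mkcond; apply: eq_bigr => A _; case: ifPn => [AN|].
    apply: eq_bigr => i _; case: ifPn => // iA.
    by rewrite (disjointFr AN iA).
  case/pred0Pn => i /= /andP[iA iN].
  by rewrite (bigD1 i) //= iA [i \in N]iN mul0r.
rewrite [RHS]big_mkcond; apply: eq_bigr => i _.
by case: ifP => _; rewrite ?add0r // addrC subrK.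
Qed.

Lemma sample_prob_mem pi i : \sum_(A : {set I} | i \in A) sample_prob pi A = pi i.
Proof.
have := sum_sample_prob pi; rewrite (bigID (fun A : {set I} => i \in A)) /=.
have -> : \sum_(A : {set I} | i \notin A) sample_prob pi A = 1 - pi i.
  have <- : \prod_(j in pred1 i) (1 - pi j) = 1 - pi i by rewrite big_pred1_eq.
  rewrite -sample_prob_disjoint.
  by apply: eq_bigl => A; rewrite disjoint_sym disjoint1.
by move=> H; lra.
Qed.

Lemma sample_prob_sum pi (c : I -> R) :
  \sum_A sample_prob pi A * \sum_(i in A) c i = \sum_i pi i * c i.
Proof.
under eq_bigr do rewrite big_distrr /=.
rewrite (exchange_big_dep xpredT) //=; apply: eq_bigr => i _.
by rewrite -big_distrl /= sample_prob_mem.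
Qed.

Lemma expR_le1D2 (v : R) : 0 <= v <= 2^-1 -> expR v <= 1 + 2 * v.
Proof.
move=> /andP[v_ge0 v_le]; have := expR_ge1Dx (- v); rewrite expRN => H.
have e_gt0 := expR_gt0 v.
have : (1 - v) * expR v <= 1.
  by rewrite -ler_pdivlMr // div1r.
have : 0 <= (1 + 2 * v) * (1 - v) - 1 by nra.
nra.
Qed.

Lemma expRN_le (v : R) : 0 <= v <= 1 -> expR (- v) <= 1 - v / 2.
Proof.
move=> /andP[v_ge0 v_le]; have := expR_ge1Dx v => H.
rewrite expRN -div1r ler_pdivrMr ?expR_gt0 //.
have : 0 <= (1 - v / 2) * (1 + v) - 1 by nra.
nra.
Qed.

(** A truncated factor is 0, any other is at most [expR (- w i)]; as [z <= 1], the exponential is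
    then bounded linearly. *)
Lemma prod_1minus_le (N : {pred I}) (w : I -> R) (z : R) :
    (forall i, i \in N -> 0 <= w i) -> 0 <= z <= 1 -> z <= \sum_(i in N) w i ->
  \prod_(i in N) (1 - Num.min 1 (w i)) <= 1 - z / 2.
Proof.
move=> w_ge0 z01 z_le.
apply: le_trans (expRN_le z01).
apply: (@le_trans _ _ (expR (- \sum_(i in N) w i))); last by rewrite ler_expR lerN2.
rewrite -sumrN expR_sum; apply: ler_prod => i iN.
rewrite subr_ge0 ge_min lexx /=; case: (leP 1 (w i)) => _.
  by rewrite subrr expR_ge0.
by have := expR_ge1Dx (- w i).
Qed.

End IndependentSampling.

(** * The rules for a single request, and their one-step estimates *)

Section LocalRules.
Context {R : realType} {m : nat}.
Variable c : 'I_m.+1 -> R.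

Implicit Types (F A : {set 'I_m.+1}) (r : request R m.+1) (s : 'I_m.+1 -> R).

Definition price F r i : R := (if i \in F then 0 else c i) + r i.

Definition cheapest F r : 'I_m.+1 := [arg min_(i < ord0) price F r i]%O.

(** Validity of a policy quantifies over all requests, also negative ones; the maximum with 0 keeps
    the opening probabilities nonnegative. *)
Definition residual F r : R := Num.max 0 (price F r (cheapest F r)).

Definition near F r : {pred 'I_m.+1} := [pred i | r i <= residual F r / 2].

Definition mass s : R := \sum_i expR (s i).

Definition weight s i : R := expR (s i) / mass s.

(* A facility of cost 0 contributes 0 here, because x / 0 = 0; this is harmless,
   since near_cost below excludes it as soon as the residual is positive. *)
Definition coverage F s r : R := \sum_(i in near F r) weight s i / c i.

Definition open_prob F s r i : R := Num.min 1 (residual F r * (weight s i / c i)).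

Definition decide F r A : Defs.action m.+1 := (cheapest F r |: A, cheapest F r).

Definition answer_prob F s r (a : Defs.action m.+1) : R :=
  \sum_A sample_prob (open_prob F s r) A * (a == decide F r A)%:R.

(** A multiplicative-weights step. Dividing by [c i] makes [c i] times the increase a quarter of the
    residual for every near [i]; by [near_cost] the increase is at most 1/2, the range of
    [expR_le1D2]. *)
Definition boost (b : R) F s r i : R :=
  if (b * coverage F s r <= 1) && (i \in near F r)
  then s i + residual F r / (4 * c i) else s i.

Hypothesis c_ge0 : forall i, 0 <= c i.

Lemma cheapest_le F r i : price F r (cheapest F r) <= price F r i.
Proof. by rewrite /cheapest; case: arg_minP => // j _; apply. Qed.

Lemma residual_ge0 F r : 0 <= residual F r.
Proof. by rewrite /residual le_max lexx. Qed.

Lemma residual_le F r i : 0 <= r i -> residual F r <= price F r i.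
Proof.
move=> r_ge0; rewrite /residual ge_max cheapest_le andbT /price addr_ge0 //.
by case: ifP.
Qed.

Lemma residual_subset F F' r : F \subset F' -> residual F' r <= residual F r.
Proof.
move=> FF'; rewrite /residual ge_max le_max lexx /= le_max; apply/orP; right.
apply: le_trans (cheapest_le _ _ (cheapest F r)) _.
rewrite /price lerD2r; case: ifPn; first by case: ifP.
by case: ifP => // /(fintype.subsetP FF') ->.
Qed.

Lemma residual_open F F' r i :
  i \in F' -> i \in near F r -> residual F' r <= residual F r / 2.
Proof.
move=> iF' near_i; rewrite {1}/residual ge_max divr_ge0 ?residual_ge0 //=.
apply: le_trans (cheapest_le _ _ i) _.
by rewrite /price iF' add0r.
Qed.

(** The price of [i] is at least the residual and connecting takes at most half of it, so opening
    accounts for the rest. An open near facility would force the residual to be 0. *)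
Lemma near_cost F r i : i \in near F r -> residual F r <= 2 * c i.
Proof.
rewrite inE; have [->|res_neq0] := eqVneq (residual F r) 0.
  by move=> _; rewrite mulr_ge0.
have : 0 < residual F r by rewrite lt_def res_neq0 residual_ge0.
have := cheapest_le F r i; rewrite /residual.
case: (leP 0 (price F r (cheapest F r))); last by rewrite ltxx.
by move=> _; rewrite {2}/price; case: ifP => _; lra.
Qed.

Lemma mass_gt0 s : 0 < mass s.
Proof.
rewrite /mass (bigD1 ord0) //= ltr_pwDl ?expR_gt0 //.
by apply: sumr_ge0 => i _; apply: expR_ge0.
Qed.

Lemma weight_ge0 s i : 0 <= weight s i.
Proof. by rewrite divr_ge0 ?expR_ge0 // ltW // mass_gt0. Qed.

Lemma sum_weight s : \sum_i weight s i = 1.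
Proof. by rewrite -mulr_suml divff // gt_eqF // mass_gt0. Qed.

Lemma unit_weight_ge0 s i : 0 <= weight s i / c i.
Proof. by rewrite mulr_ge0 ?invr_ge0 ?weight_ge0. Qed.

Lemma coverage_ge0 F s r : 0 <= coverage F s r.
Proof. by apply: sumr_ge0 => i _; apply: unit_weight_ge0. Qed.

Lemma open_prob01 F s r i : 0 <= open_prob F s r i <= 1.
Proof.
rewrite /open_prob ge_min lexx /= andbT le_min ler01 /=.
by rewrite mulr_ge0 ?residual_ge0 ?unit_weight_ge0.
Qed.

Lemma expect_answer F s r (f : Defs.action m.+1 -> R) :
  \sum_a answer_prob F s r a * f a =
  \sum_A sample_prob (open_prob F s r) A * f (decide F r A).
Proof.
under eq_bigr do rewrite mulr_suml.
rewrite exchange_big /=; apply: eq_bigr => A _.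
rewrite (bigD1 (decide F r A)) //= eqxx mulr1 big1 ?addr0 // => a /negPf ->.
by rewrite mulr0 mul0r.
Qed.

(** Without truncation [c i] cancels, leaving the residual times [weight s i], and the weights sum
    to 1. *)
Lemma expected_opening_le F s r :
  \sum_A sample_prob (open_prob F s r) A * \sum_(i in A) c i <= residual F r.
Proof.
rewrite sample_prob_sum -[leRHS]mulr1 -(sum_weight s) mulr_sumr.
apply: ler_sum => i _; apply: (@le_trans _ _ (residual F r * (weight s i / c i) * c i)).
  by rewrite ler_wpM2r // ge_min lexx orbT.
have [->|c_neq0] := eqVneq (c i) 0.
  by rewrite mulr0 mulr_ge0 ?residual_ge0 ?weight_ge0.
by rewrite -mulrA divfK.
Qed.

(** One residual pays for the cheapest facility and the connection, the other for the sample. *)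
Lemma expected_step_cost_le n (d : 'I_m.+1 -> 'I_n -> R) F s e :
  (forall i e, 0 <= d i e) ->
  \sum_A sample_prob (open_prob F s (d^~ e)) A *
     step_cost c d F (e, decide F (d^~ e) A) <= 2 * residual F (d^~ e).
Proof.
move=> d_ge0; set r := d^~ e; set P := sample_prob _.
have P_ge0 A : 0 <= P A by apply: sample_prob_ge0 => i; apply: open_prob01.
apply: (@le_trans _ _ (\sum_A P A * (\sum_(i in A) c i + residual F r))).
  apply: ler_sum => A _; rewrite ler_wpM2l // /step_cost /=.
  have -> : d (cheapest F r) e = r (cheapest F r) by [].
  have : price F r (cheapest F r) <= residual F r by rewrite /residual le_max lexx orbT.
  rewrite /price; set j := cheapest F r; move=> Hj.
  have : \sum_(i in (j |: A) :\: F) c i <= \sum_(i in A) c i + (if j \in F then 0 else c j).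
    rewrite [X in _ + X](_ : _ = \sum_(i | (i == j) && (i \notin F)) c i); last first.
      case: ifPn => jF; last rewrite (big_pred1 j) // => i; last first.
        by rewrite andb_idr // => /eqP ->.
      by rewrite big_pred0 // => i; case: eqP => // ->; rewrite jF.
    rewrite [leLHS]big_mkcond [X in _ <= X + _]big_mkcond [X in _ <= _ + X]big_mkcond.
    rewrite -big_split /=; apply: ler_sum => i _; rewrite !inE.
    by case: (i \in F) (i == j) (i \in A) => [] [] [] /=; rewrite ?addr0 ?add0r ?lerDl.
  by move=> Hs; apply: le_trans (lerD Hs (lexx (r j))) _; rewrite -addrA lerD2l.
under eq_bigr do rewrite mulrDr.
rewrite big_split /= -mulr_suml sum_sample_prob mul1r.
by have := expected_opening_le F s r; rewrite -/P; lra.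
Qed.

Lemma sampling_gain F s (r r' : request R m.+1) (b : R) (j : 'I_m.+1) : 0 < b ->
    residual F r <= b ->
  \sum_A sample_prob (open_prob F s r) A * residual (F :|: (j |: A)) r' <=
  residual F r' * (1 - residual F r * Num.min 1 (b * coverage F s r') / (4 * b)).
Proof.
move=> b_gt0 res_le; set P := sample_prob _; set k := residual F r.
have k_ge0 : 0 <= k := residual_ge0 F r.
have k'_ge0 := residual_ge0 F r'.
have P_ge0 A : 0 <= P A by apply: sample_prob_ge0 => i; apply: open_prob01.
set x := Num.min 1 _.
have x_ge0 : 0 <= x by rewrite le_min ler01 mulr_ge0 ?coverage_ge0 // ltW.
have x_le1 : x <= 1 by rewrite ge_min lexx.
set N := near F r'.
(* The opening rates on [N] sum to [k] times the coverage, which is at least [k * x / b]; this is at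
   most 1 because [k <= b]. *)
have miss : \sum_(A : {set 'I_m.+1} | [disjoint A & N]) P A <= 1 - (k * x / b) / 2.
  rewrite sample_prob_disjoint; apply: prod_1minus_le => [i _||].
  - by rewrite mulr_ge0 ?unit_weight_ge0.
  - apply/andP; split; first by rewrite divr_ge0 ?mulr_ge0 // ltW.
    by rewrite ler_pdivrMr // mul1r; apply: le_trans res_le; rewrite ler_piMr.
  rewrite -mulr_sumr ler_pdivrMr // -mulrA ler_wpM2l // mulrC.
  by rewrite ge_min lexx orbT.
(* A hit at least halves the residual of [r'], and a miss does not raise it. *)
apply: (@le_trans _ _ (residual F r' / 2 * (1 + \sum_(A : {set 'I_m.+1} | [disjoint A & N]) P A))).
  rewrite -[X in _ * (X + _)](sum_sample_prob (open_prob F s r)) -/P mulrDr !mulr_sumr.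
  rewrite [X in _ <= _ + X]big_mkcond -big_split /=; apply: ler_sum => A _.
  case: ifPn => [_|].
    have := ler_wpM2l (P_ge0 A) (residual_subset r' (finset.subsetUl F (j |: A))); lra.
  case/pred0Pn => i /= /andP[iA iN]; rewrite addr0 mulrC ler_wpM2r //.
  by apply: (residual_open (i := i)); rewrite // !inE [i \in A]iA !orbT.
rewrite -mulrA ler_wpM2l // mulrC ler_pdivrMr //.
apply: le_trans (lerD (lexx 1) miss) _.
have -> : (1 - k * x / (4 * b)) * 2 = 2 - k * x / b / 2 by field; rewrite gt_eqF.
by lra.
Qed.

End LocalRules.

(** * Drift of the backlog under a uniformly random arrival *)

Lemma ln_tangent {R : realType} (x y : R) : 0 < x -> 0 < y ->
  ln y - ln x <= (y - x) / x.
Proof.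
move=> x_gt0 y_gt0; rewrite -ln_div ?posrE // mulrBl divff ?gt_eqF //.
have := expR_ge1Dx (ln (y / x)); rewrite lnK ?posrE ?divr_gt0 //.
by lra.
Qed.

(* The change of the backlog, summed over the arriving client e: k and x stand
   for the residuals and for min 1 (b * coverage), the quotient
   (r - 1) / (u - 1) is 0 for u = 1. *)
Lemma backlog_drift {R : realType} {n : nat} (U : {set 'I_n}) (r : nat) (k x : 'I_n -> R) (b : R) :
    0 < b -> (0 < r <= #|U|)%N ->
    (forall e, 0 <= k e <= b) -> (forall e, 0 <= x e <= 1) ->
  \sum_(e in U) (r.-1%:R / #|U :\ e|%:R *
      (\sum_(f in U :\ e) k f * (1 - k e * x f / (4 * b)))
    - r%:R / #|U|%:R * \sum_(f in U) k f)
  <= - ((\sum_(e in U) k e * x e) / (4 * b) *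
        (b + r%:R / #|U|%:R * \sum_(e in U) k e)).
Proof.
move=> b_gt0 /andP[r_gt0 r_le] kP xP.
set T := \sum_(f in U) k f; set Y := \sum_(e in U) k e * x e.
set u := #|U|; have u_gt0 : (0 < u)%N := leq_trans r_gt0 r_le.
have u_pos : 0 < u%:R :> R by rewrite ltr0n.
pose al : R := r.-1%:R / u.-1%:R; pose rho : R := r%:R / u%:R.
have k_ge0 e : 0 <= k e by have /andP[] := kP e.
have x_ge0 e : 0 <= x e by have /andP[] := xP e.
have k_le e : k e <= b by have /andP[] := kP e.
have x_le e : x e <= 1 by have /andP[] := xP e.
have T_ge0 : 0 <= T by apply: sumr_ge0.
have Y_ge0 : 0 <= Y by apply: sumr_ge0 => e _; rewrite mulr_ge0.
have YT : Y <= T by apply: ler_sum => e _; rewrite ler_piMr.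
have Tub : T <= u%:R * b.
  by rewrite mulr_natl -sumr_const; apply: ler_sum => e _.
have al_ge0 : 0 <= al by rewrite divr_ge0.
have r1 : r%:R = 1 + r.-1%:R :> R by rewrite -{1}(prednK r_gt0) -natr1 addrC.
have u1 : u%:R = 1 + u.-1%:R :> R by rewrite -{1}(prednK u_gt0) -natr1 addrC.
have ru : r.-1%:R <= u.-1%:R :> R by rewrite ler_nat -!subn1 leq_sub2r.
(* For [u = 1] also [r = 1], so the default value of the quotient does no harm. *)
have alu : al * u.-1%:R = r.-1%:R.
  have [u0|u_neq0] := eqVneq (u.-1%:R : R) 0; last by rewrite /al divfK.
  by rewrite u0 mulr0; apply/eqP; rewrite eq_sym eq_le ler0n andbT -u0.
have al_le1 : al <= 1.
  have [u0|u_neq0] := eqVneq (u.-1%:R : R) 0; first by rewrite /al u0 invr0 mulr0.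
  by rewrite ler_pdivrMr ?mul1r // lt_def u_neq0 ler0n.
have rho_al : (rho - al) * u%:R <= 1.
  by rewrite mulrBl /rho divfK ?gt_eqF // u1 mulrDr alu mulr1; lra.
have kx_le : \sum_(e in U) k e * (k e * x e) <= b * Y.
  by rewrite mulr_sumr; apply: ler_sum => e _; rewrite ler_wpM2r ?mulr_ge0.
set Z := \sum_(e in U) k e * (k e * x e) in kx_le.
have Z_ge0 : 0 <= Z by apply: sumr_ge0 => e _; rewrite !mulr_ge0.
have -> : \sum_(e in U) (r.-1%:R / #|U :\ e|%:R *
      (\sum_(f in U :\ e) k f * (1 - k e * x f / (4 * b))) - rho * T)
  = \sum_(e in U) (al * (T - k e - (k e * Y - k e * (k e * x e)) / (4 * b)) - rho * T).
  apply: eq_bigr => e eU; congr (_ * _ - _).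
    by rewrite /al /u (cardsD1 e U) eU.
  have -> : T = k e + \sum_(f in U :\ e) k f by rewrite /T (big_setD1 e).
  have -> : Y = k e * x e + \sum_(f in U :\ e) k f * x f by rewrite /Y (big_setD1 e).
  transitivity (\sum_(f in U :\ e) k f
                - k e * (\sum_(f in U :\ e) k f * x f) / (4 * b)); last by ring.
  by rewrite mulr_sumr mulr_suml -sumrB; apply: eq_bigr => f _; ring.
rewrite sumrB -mulr_sumr !sumrB -mulr_suml sumrB -mulr_suml !sumr_const.
rewrite -/T -/Z -/u -[T *+ u]mulr_natl -[(rho * T) *+ u]mulr_natl.
rewrite -/rho.
have -> : u%:R * (rho * T) = r%:R * T by rewrite /rho; field; rewrite gt_eqF.
(* By [alu] the main terms will leave [(r - 1) * T - r * T = - T]. *)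
have -> : al * (u%:R * T - T - (T * Y - Z) / (4 * b))
  = r.-1%:R * T - al * (T * Y - Z) / (4 * b).
  by rewrite -alu u1; field; rewrite gt_eqF.
(* Replacing [al] by [rho] and including the diagonal [Z] cost [b * Y] each; divided by [4 * b] this
   is [Y / 2], which [- T <= - Y] absorbs. *)
have H : rho * T * Y - al * (T * Y - Z) <= 2 * (b * Y).
  have : (rho - al) * T * Y <= b * Y.
    rewrite ler_wpM2r //; have [H|H] := leP (rho - al) 0.
      by apply: le_trans (ltW b_gt0); rewrite mulr_le0_ge0.
    apply: le_trans (ler_wpM2l (ltW H) Tub) _; rewrite mulrA.
    by rewrite ler_piMl // ltW.
  by have := ler_piMl Z_ge0 al_le1; lra.
have {}H : (rho * T * Y - al * (T * Y - Z)) / (4 * b) <= Y / 2.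
  by rewrite ler_pdivrMr ?mulr_gt0 //; lra.
rewrite r1; have -> : Y / (4 * b) * (b + rho * T) = Y / 4 + rho * T * Y / (4 * b).
  by field; rewrite gt_eqF.
rewrite mulrBl in H; lra.
Qed.

(** * The potential relative to a fixed offline solution *)

Section Potential.
Context {R : realType} {m n : nat}.
Variables (c : 'I_m.+1 -> R) (d : 'I_m.+1 -> 'I_n -> R).
Variables (Fopt : {set 'I_m.+1}) (phi : 'I_n -> 'I_m.+1) (O : R).
Hypotheses (c_ge0 : forall i, 0 <= c i) (d_ge0 : forall i e, 0 <= d i e).
Hypotheses (phi_in : forall e, phi e \in Fopt).
Hypothesis cost_le_O : \sum_(i in Fopt) c i + \sum_e d (phi e) e <= O.
Hypothesis O_gt0 : 0 < O.

Implicit Types (F A : {set 'I_m.+1}) (U : {set 'I_n}) (s : 'I_m.+1 -> R).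

Local Notation res F e := (residual c F (d^~ e)).
Local Notation hit b F s e := (Num.min 1 (b * coverage c F s (d^~ e))).

(** As [ln (mass s) - s i] is minus the logarithm of [weight s i], this is, up to scaling and an
    additive constant, the relative entropy to the weights from the distribution on [Fopt]
    proportional to [c]. *)
Definition deficit s : R := \sum_(i in Fopt) c i * (ln (mass s) - s i).

(** In random order a client of [U] is among the next [r] arrivals with probability [r / #|U|]: this
    is the expected total of their current residuals. *)
Definition backlog F U (r : nat) : R := r%:R / #|U|%:R * \sum_(e in U) res F e.

(* The three terms pay, respectively, for the steps on which boost learns, for
   those on which sampling shrinks the residuals of the clients still to come
   (b * coverage > 1), and for the connection costs of the comparison solution. *)
Definition potential F s (b : R) U (r : nat) : R :=
  4 * deficit s + 8 * b * ln (1 + backlog F U r / b) + 2 * \sum_(e in U) d (phi e) e.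

Lemma res_le_O F e : res F e <= O.
Proof.
apply: le_trans (residual_le c_ge0 F (d_ge0 (phi e) e)) _; apply: le_trans cost_le_O.
rewrite /price (bigD1 (phi e)) //= [X in _ <= _ + X](bigD1 e) //= lerD //.
  rewrite -[leLHS]addr0 lerD ?sumr_ge0 //; by case: ifP.
by rewrite lerDl sumr_ge0.
Qed.

Lemma deficit_ge0 s : 0 <= deficit s.
Proof.
apply: sumr_ge0 => i _; rewrite mulr_ge0 // subr_ge0 -[s i]expRK ler_ln ?posrE ?expR_gt0 ?mass_gt0 //.
by rewrite /mass (bigD1 i) //= lerDl sumr_ge0 // => j _; apply: expR_ge0.
Qed.

Lemma backlog_ge0 F U r : 0 <= backlog F U r.
Proof.
by rewrite mulr_ge0 ?divr_ge0 // sumr_ge0 // => e _; apply: residual_ge0.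
Qed.

Lemma potential_ge0 F s b U r : 0 < b -> 0 <= potential F s b U r.
Proof.
move=> b_gt0; rewrite /potential !addr_ge0 ?mulr_ge0 ?deficit_ge0 ?sumr_ge0 ?(ltW b_gt0) //.
by rewrite ln_ge0 // lerDl divr_ge0 ?backlog_ge0 // ltW.
Qed.

(** Linearising the exponential costs a factor 2, which turns the rate 1/4 of [boost] into 1/2. *)
Lemma mass_boost_le b F s r : b * coverage c F s r <= 1 ->
  mass (boost c b F s r) - mass s <= mass s * (residual c F r * coverage c F s r / 2).
Proof.
move=> bQ; set k := residual c F r; have k_ge0 : 0 <= k := residual_ge0 _ _ _.
have -> : mass (boost c b F s r) - mass s = \sum_i (expR (boost c b F s r i) - expR (s i)).
  by rewrite sumrB.
rewrite /coverage [k * _]mulr_sumr mulr_suml mulr_sumr [leRHS]big_mkcond.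
apply: ler_sum => i _; rewrite /boost bQ /=; case: ifPn => [near_i|_]; last by rewrite subrr.
have inc : 0 <= k / (4 * c i) <= 2^-1.
  rewrite divr_ge0 ?mulr_ge0 //=; have := near_cost c_ge0 near_i; rewrite -/k.
  have [->|c_neq0] := eqVneq (c i) 0; first by rewrite !mulr0 invr0 mulr0 invr_ge0.
  by rewrite ler_pdivrMr; [lra | rewrite mulr_gt0 // lt_def c_neq0 c_ge0].
have := expR_le1D2 inc; rewrite expRD -/k => H.
have e_ge0 := expR_ge0 (s i).
have -> : mass s * (k * (weight s i / c i) / 2) = expR (s i) * (2 * (k / (4 * c i))).
  have -> : expR (s i) = weight s i * mass s by rewrite divfK // gt_eqF // mass_gt0.
  have [->|c_neq0] := eqVneq (c i) 0; last by field.
  by rewrite !(mulr0, invr0, mul0r).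
by have := ler_wpM2l e_ge0 H; lra.
Qed.

(** If [b * coverage > 1], nothing is boosted and the right side is twice the residual. Otherwise
    the growth of the mass costs at most the right side; a near [phi e] gains a quarter of the
    residual, and a far one has connection cost above half of it. *)
Lemma deficit_boost_le b F s e : O <= b ->
  res F e + 4 * (deficit (boost c b F s (d^~ e)) - deficit s) - 2 * d (phi e) e
  <= 2 * (res F e * hit b F s e).
Proof.
move=> Ob; set k := res F e; have k_ge0 : 0 <= k := residual_ge0 _ _ _.
have dphi_ge0 := d_ge0 (phi e) e.
set Q := coverage c F s (d^~ e); set s' := boost _ _ _ _ _.
have Q_ge0 : 0 <= Q by apply: coverage_ge0.
have [bQ|bQ] := leP (b * Q) 1; last first.
  have -> : deficit s' = deficit s.
    apply: eq_bigr => i _; rewrite /s' /boost /mass.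
    by rewrite leNgt bQ /=.
  by lra.
have lnS : ln (mass s') - ln (mass s) <= k * Q / 2.
  apply: le_trans (ln_tangent (mass_gt0 s) (mass_gt0 s')) _.
  by rewrite ler_pdivrMr ?mass_gt0 // mulrC mass_boost_le.
have -> : deficit s' - deficit s =
    (\sum_(i in Fopt) c i) * (ln (mass s') - ln (mass s)) - \sum_(i in Fopt) c i * (s' i - s i).
  by rewrite /deficit mulr_suml -!sumrB; apply: eq_bigr => i _; ring.
have s'_ge i : 0 <= s' i - s i.
  rewrite /s' /boost; case: ifP => _; rewrite ?subrr //.
  by rewrite addrAC subrr add0r divr_ge0 ?mulr_ge0.
have cF_le : \sum_(i in Fopt) c i <= b.
  apply: le_trans Ob; apply: le_trans cost_le_O.
  by rewrite lerDl sumr_ge0.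
have cF_ge0 : 0 <= \sum_(i in Fopt) c i by rewrite sumr_ge0.
have bound1 : (\sum_(i in Fopt) c i) * (ln (mass s') - ln (mass s)) <= b * (k * Q / 2).
  apply: le_trans (ler_wpM2l cF_ge0 lnS) _; rewrite ler_wpM2r //.
  by rewrite divr_ge0 ?mulr_ge0.
have bound2 : k / 4 - d (phi e) e / 2 <= \sum_(i in Fopt) c i * (s' i - s i).
  rewrite (bigD1 (phi e)) //=.
  have rest_ge0 : 0 <= \sum_(i in Fopt | i != phi e) c i * (s' i - s i).
    by rewrite sumr_ge0 // => i _; rewrite mulr_ge0.
  have [near_phi|] := boolP (phi e \in near c F (d^~ e)); last first.
    rewrite inE -ltNge -/k => far; have := mulr_ge0 (c_ge0 (phi e)) (s'_ge (phi e)).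
    by move: far rest_ge0; lra.
  have -> : c (phi e) * (s' (phi e) - s (phi e)) = k / 4.
    rewrite /s' /boost bQ near_phi /= addrAC subrr add0r -/k.
    have [c0|c_neq0] := eqVneq (c (phi e)) 0; last by field.
    have := near_cost c_ge0 near_phi; rewrite c0 mulr0 -/k => k_le0.
    have -> : k = 0 by apply/eqP; rewrite eq_le k_le0.
    by rewrite !mul0r.
  by lra.
by lra.
Qed.

Lemma potential_drift F s b U r : O <= b -> (0 < r <= #|U|)%N ->
  \sum_(e in U) \sum_A sample_prob (open_prob c F s (d^~ e)) A *
    (res F e + potential (F :|: (decide c F (d^~ e) A).1) (boost c b F s (d^~ e)) b (U :\ e) r.-1)
  <= #|U|%:R * potential F s b U r.
Proof.
move=> Ob rP; have b_gt0 : 0 < b := lt_le_trans O_gt0 Ob.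
set P := fun e => sample_prob (open_prob c F s (d^~ e)).
have P_ge0 e A : 0 <= P e A by apply: sample_prob_ge0 => i; apply: open_prob01.
have P_cst e y : \sum_A P e A * y = y.
  by rewrite -mulr_suml /P sum_sample_prob mul1r.
set F' := fun e A => F :|: (decide c F (d^~ e) A).1.
set K := backlog F U r; have K_ge0 : 0 <= K := backlog_ge0 _ _ _.
have bK_gt0 : 0 < b + K by rewrite ltr_pwDl.
have step e A : e \in U ->
    res F e + potential (F' e A) (boost c b F s (d^~ e)) b (U :\ e) r.-1
    <= potential F s b U r + 2 * (res F e * hit b F s e)
       + 8 * b / (b + K) * (backlog (F' e A) (U :\ e) r.-1 - K).
  move=> eU; have := deficit_boost_le F s e Ob.
  rewrite /potential -/K; set K' := backlog _ _ r.-1.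
  have K'_ge0 : 0 <= K' := backlog_ge0 _ _ _.
  rewrite (big_setD1 e eU) /=.
  (* Concavity makes the bound linear in [K'], so that expectations can be taken termwise. *)
  have lnK : ln (1 + K' / b) - ln (1 + K / b) <= (K' - K) / (b + K).
    apply: le_trans (ln_tangent _ _) _; rewrite ?ltr_wpDr ?divr_ge0 ?(ltW b_gt0) //.
    rewrite [leLHS](_ : _ = (K' - K) / (b + K)) //.
    by field; rewrite !gt_eqF.
  have := ler_wpM2l (mulr_ge0 (ler0n R 8) (ltW b_gt0)) lnK.
  have -> : 8 * b * ((K' - K) / (b + K)) = 8 * b / (b + K) * (K' - K) by ring.
  by lra.
apply: (@le_trans _ _ (\sum_(e in U) (potential F s b U r + 2 * (res F e * hit b F s e)
   + 8 * b / (b + K) * (r.-1%:R / #|U :\ e|%:R *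
      (\sum_(f in U :\ e) res F f * (1 - res F e * hit b F s f / (4 * b))) - K)))).
  apply: ler_sum => e eU.
  apply: le_trans (ler_sum _ (fun A _ => ler_wpM2l (P_ge0 e A) (step e A eU))) _.
  under [leLHS]eq_bigr do rewrite mulrDr.
  rewrite big_split /= P_cst lerD2l.
  under [leLHS]eq_bigr do rewrite mulrCA.
  rewrite -mulr_sumr ler_wpM2l ?divr_ge0 ?mulr_ge0 ?(ltW b_gt0) ?(ltW bK_gt0) //.
  under [leLHS]eq_bigr do rewrite mulrBr.
  rewrite sumrB P_cst lerB //.
  under [leLHS]eq_bigr do rewrite mulrCA.
  rewrite -mulr_sumr ler_wpM2l ?divr_ge0 //.
  under [leLHS]eq_bigr do rewrite mulr_sumr.
  rewrite exchange_big /=; apply: ler_sum => f _.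
  have := sampling_gain c_ge0 (r := d^~ e) s (d^~ f) (cheapest c F (d^~ e)) b_gt0.
  by apply; apply: le_trans Ob; apply: res_le_O.
have k_bnd e : 0 <= res F e <= b.
  by rewrite residual_ge0 (le_trans (res_le_O _ _) Ob).
have x_bnd e : 0 <= hit b F s e <= 1.
  by rewrite ge_min lexx le_min ler01 mulr_ge0 ?coverage_ge0 // ltW.
have lin (p q : R) (f g : 'I_n -> R) : \sum_(e in U) (p + 2 * f e + q * g e)
    = #|U|%:R * p + 2 * (\sum_(e in U) f e) + q * (\sum_(e in U) g e).
  by rewrite !big_split /= -!mulr_sumr sumr_const -[_ *+ #|U|]mulr_natl.
rewrite lin; set Y := \sum_(e in U) res F e * hit b F s e; set D := \sum_(e in U) _.
have D_le : D <= - (Y / (4 * b) * (b + K)) := backlog_drift b_gt0 rP k_bnd x_bnd.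
have := ler_wpM2l (divr_ge0 (mulr_ge0 (ler0n R 8) (ltW b_gt0)) (ltW bK_gt0)) D_le.
(* The coefficient 8 of the logarithm is chosen so that its drift cancels the [2 * Y] left by
   [deficit_boost_le]. *)
have -> : 8 * b / (b + K) * - (Y / (4 * b) * (b + K)) = - (2 * Y).
  by field; rewrite !gt_eqF.
by lra.
Qed.

End Potential.

(** * The online algorithm, with its guesses of the optimum and of the horizon *)

Section Algorithm.
Context {R : realType} {m : nat}.
Variable c : 'I_m.+1 -> R.

(* guess estimates the optimum and only grows within a level; spent is the
   sum of the residuals paid since the guess last changed. The number of clients
   being unknown, time is cut into levels on which the logarithm of the horizon is
   correct up to a factor 2. *)
Record state := State {
  clock : nat;
  level : nat;
  bought : {set 'I_m.+1};
  guess : R;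
  spent : R;
  score : 'I_m.+1 -> R }.

(** The base exceeds the number [m.+1] of facilities, so its logarithm bounds that of the initial
    mass and is positive even for a single facility. *)
Definition horizon (j : nat) : nat := (m.+2 ^ (2 ^ j))%N.

Definition budget (j : nat) : R := 24 * 2 ^+ j * ln m.+2%:R.

Definition start : state := State 0 0 finset.set0 0 0 (fun=> 0).

(** A residual never exceeds the optimum, so one above the guess refutes the guess. Overspending
    refutes nothing, but pays for a restart at twice the guess. *)
Definition advance (st : state) (x : request R m.+1 * Defs.action m.+1) : state :=
  let t := (clock st).+1 in
  let F := bought st :|: x.2.1 in
  let k := residual c (bought st) x.1 in
  if (horizon (level st) <= t)%N then State t (level st).+1 F 0 0 (fun=> 0)
  else if guess st < k then
    State t (level st) F (Num.max (2 * guess st) k) 0 (fun=> 0)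
  else if 4 * guess st * budget (level st) < spent st + k then
    State t (level st) F (2 * guess st) 0 (fun=> 0)
  else State t (level st) F (guess st) (spent st + k)
         (boost c (guess st) (bought st) (score st) x.1).

Definition run (h : history R m.+1) : state := foldl advance start h.

Definition learn_or_open : policy R m.+1 := fun h r =>
  answer_prob c (bought (run h)) (score (run h)) r.

Lemma run_rcons h x : run (rcons h x) = advance (run h) x.
Proof. by rewrite /run -cats1 foldl_cat. Qed.

Lemma clock_run h : clock (run h) = size h.
Proof.
elim/last_ind: h => // h x IH; rewrite run_rcons size_rcons -IH /advance.
by do 3!case: ifP => // _.
Qed.

Lemma bought_run h : bought (run h) = opened h.
Proof.
elim/last_ind: h => [|h x IH]; first by rewrite /opened big_nil.
rewrite run_rcons opened_rcons -IH /advance.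
by do 3!case: ifP => // _.
Qed.

Lemma ln2_ge : 2^-1 <= ln 2 :> R.
Proof.
rewrite -[leLHS]expRK ler_ln ?posrE ?expR_gt0 //.
have := @expR_le1D2 R 2^-1; rewrite lexx invr_ge0 ler0n /= => /(_ isT).
by lra.
Qed.

Lemma ln_base_ge : 2^-1 <= ln m.+2%:R :> R.
Proof. by apply: le_trans ln2_ge _; rewrite ler_ln ?posrE ?ltr0n // ler_nat. Qed.

Lemma budget_ge1 j : 1 <= budget j.
Proof.
have p_ge1 : 1 <= 2 ^+ j :> R by rewrite exprn_ege1 // ler1n.
have := ler_pM (ler01) _ p_ge1 ln_base_ge; rewrite /budget => /(_ _); rewrite invr_ge0 ler0n => /(_ isT).
by lra.
Qed.

Lemma budgetS j : budget j.+1 = 2 * budget j.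
Proof. by rewrite /budget exprS; ring. Qed.

Lemma horizon_ge2 j : (2 <= horizon j)%N.
Proof.
rewrite /horizon; apply: (@leq_trans (m.+2 ^ 1)) => //.
by rewrite leq_exp2l // expn_gt0.
Qed.

Lemma horizonS j : horizon j.+1 = (horizon j * horizon j)%N.
Proof. by rewrite /horizon expnS mul2n -addnn expnD. Qed.

Lemma ln_horizon j : ln (horizon j)%:R = 2 ^+ j * ln m.+2%:R :> R.
Proof. by rewrite /horizon natrX lnXn ?ltr0n // -[LHS]mulr_natl natrX. Qed.

Definition consistent (st : state) : Prop :=
  [/\ 0 <= guess st, 0 <= spent st <= 4 * guess st * budget (level st),
      (clock st < horizon (level st))%N
    & forall j, level st = j.+1 -> (horizon j <= clock st)%N].

Lemma consistent_start : consistent start.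
Proof.
by split=> //=; rewrite lexx mulr0 mul0r lexx.
Qed.

Lemma consistent_advance st x : consistent st -> consistent (advance st x).
Proof.
move=> [b_ge0 /andP[G_ge0 G_le] t_lt t_ge].
have L_ge0 j : 0 <= budget j by apply: le_trans (budget_ge1 j).
have k_ge0 := residual_ge0 c (bought st) x.1.
rewrite /advance; case: ifPn => [|]; last rewrite -ltnNge => t_lt'.
  (* The clock moves by one, so a level ends exactly at its horizon, which lies below its square. *)
  move=> le_t; have Et : (clock st).+1 = horizon (level st) by apply/eqP; rewrite eqn_leq t_lt le_t.
  split=> //=; first by rewrite lexx mulr0 mul0r lexx.
    rewrite Et horizonS; have := horizon_ge2 (level st).
    by case: (horizon _) => // N N_ge; rewrite ltn_Pmull.
  by move=> j [<-]; rewrite Et.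
have t_ge' j : level st = j.+1 -> (horizon j <= (clock st).+1)%N.
  by move=> /t_ge/leqW.
case: ifPn => [_|]; last rewrite -leNgt => k_le.
  have b'_ge0 : 0 <= Num.max (2 * guess st) (residual c (bought st) x.1).
    by rewrite le_max k_ge0 orbT.
  by split=> //=; rewrite lexx mulr_ge0 ?L_ge0 ?mulr_ge0.
case: ifPn => [_|]; last rewrite -leNgt => G_le'.
  by split=> //=; rewrite ?lexx mulr_ge0 ?L_ge0 ?mulr_ge0.
by split=> //=; rewrite addr_ge0.
Qed.

Lemma consistent_run h : consistent (run h).
Proof.
elim/last_ind: h => [|h x IH]; first exact: consistent_start.
by rewrite run_rcons; apply: consistent_advance.
Qed.

Hypothesis c_ge0 : forall i, 0 <= c i.

Lemma valid_learn_or_open : valid_policy learn_or_open.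
Proof.
move=> h r; split=> [a||a].
- apply: sumr_ge0 => A _; rewrite mulr_ge0 // sample_prob_ge0 // => i.
  exact: open_prob01.
- rewrite -(sum_sample_prob (open_prob c (bought (run h)) (score (run h)) r)).
  have := expect_answer c (bought (run h)) (score (run h)) r (fun=> 1).
  by under eq_bigr do rewrite mulr1; under [RHS]eq_bigr do rewrite mulr1.
- move=> a_closed; apply: big1 => A _; case: eqP => [E|]; rewrite ?mulr0 //.
  by move: a_closed; rewrite E /= !inE eqxx orbT.
Qed.

(** * Amortisation over phases and levels *)

Section Accounting.
Variables (n : nat) (d : 'I_m.+1 -> 'I_n -> R).
Variables (Fopt : {set 'I_m.+1}) (phi : 'I_n -> 'I_m.+1) (O : R).
Hypothesis d_ge0 : forall i e, 0 <= d i e.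
Hypotheses (phi_in : forall e, phi e \in Fopt).
Hypothesis cost_le_O : \sum_(i in Fopt) c i + \sum_e d (phi e) e <= O.
Hypothesis O_gt0 : 0 < O.

Local Notation pot := (potential c d Fopt phi).

Definition rounds (st : state) (U : {set 'I_n}) : nat :=
  minn (horizon (level st) - clock st) #|U|.

(* While guess < O, the coefficients of guess and spent let a phase pay for itself
   and for the step that ends it. Once O <= guess, a phase ends only
   after spending 4 * guess * L, which pays for the at most 4 * guess * L of the
   fresh potential at 2 * guess. *)
Definition charge (st : state) (U : {set 'I_n}) : R :=
  let L := budget (level st) in
  if O <= guess st then
    2 * pot (bought st) (score st) (guess st) U (rounds st U) + spent st
  else 16 * O * L - (4 * L + 2) * guess st - spent st.

(* The reserve 32 * O * budget j is twice the initial charge of level j; as budgets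
   double, passing to the next level costs nothing and frees the old charge. *)
Definition account (T : R) (st : state) (U : {set 'I_n}) : R :=
  T - 32 * O * budget (level st) + charge st U.

(** In units of [b * 2 ^+ j * beta] the deficit term contributes 4, the logarithm 16 (from
    [1 + H <= H ^ 2] for [H >= 2]) and the connection costs 4: hence the 24 in [budget]. *)
Lemma fresh_potential_le F b (U : {set 'I_n}) r j : O <= b -> (r <= horizon j)%N ->
  pot F (fun=> 0) b U r <= b * budget j.
Proof.
move=> Ob r_le; have b_gt0 : 0 < b := lt_le_trans O_gt0 Ob.
have p_ge1 : 1 <= 2 ^+ j :> R by rewrite exprn_ege1 // ler1n.
have beta_ge := ln_base_ge; set beta := ln _ in beta_ge *.
have beta_ge0 : 0 <= beta by lra.
have d_sum_ge0 (P : pred 'I_n) : 0 <= \sum_(e | P e) d (phi e) e by rewrite sumr_ge0.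
have c_sum_ge0 : 0 <= \sum_(i in Fopt) c i by rewrite sumr_ge0.
have D_le : deficit c Fopt (fun=> 0) <= O * beta.
  apply: (@le_trans _ _ ((\sum_(i in Fopt) c i) * beta)).
    rewrite /deficit mulr_suml; apply: ler_sum => i _; rewrite ler_wpM2l // subr0.
    rewrite ler_ln ?posrE ?mass_gt0 ?ltr0n // /mass.
    rewrite (eq_bigr (fun=> 1)) => [|k _]; last by rewrite expR0.
    by rewrite sumr_const card_ord ler_nat.
  rewrite ler_wpM2r  //.
  by apply: le_trans cost_le_O; rewrite lerDl (d_sum_ge0 xpredT).
have d_le : \sum_(e in U) d (phi e) e <= O.
  apply: le_trans cost_le_O; rewrite [X in _ <= _ + X](bigID (mem U)) /=.
  by have := d_sum_ge0 (fun e => e \notin U); move: c_sum_ge0; lra.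
have K_le : backlog c d F U r / b <= (horizon j)%:R.
  rewrite ler_pdivrMr //; apply: (@le_trans _ _ (r%:R * O)); last first.
    by rewrite ler_pM ?ler_nat // ltW.
  have [u0|u_gt0] := posnP #|U|.
    by rewrite /backlog u0 invr0 mulr0 mul0r mulr_ge0 // ltW.
  rewrite /backlog -mulrA ler_wpM2l // ler_pdivrMl ?ltr0n //.
  rewrite mulr_natl -sumr_const; apply: ler_sum => e _.
  exact: (res_le_O c_ge0 d_ge0 phi_in cost_le_O).
have ln_le : ln (1 + backlog c d F U r / b) <= 2 * (2 ^+ j * beta).
  have K_ge0 : 0 <= backlog c d F U r / b by rewrite divr_ge0 ?backlog_ge0 // ltW.
  have H_ge2 : 2 <= (horizon j)%:R :> R by rewrite ler_nat horizon_ge2.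
  rewrite -ln_horizon mulr_natl -lnXn ?(lt_le_trans _ H_ge2) //.
  rewrite ler_ln ?posrE ?exprn_gt0 ?(lt_le_trans _ H_ge2) ?ltr_wpDr //.
  by rewrite expr2; nra.
have pb : beta <= 2 ^+ j * beta by rewrite ler_peMl // .
have bOb : O * beta <= b * (2 ^+ j * beta).
  by rewrite ler_pM // ?(ltW O_gt0) .
have bO : O <= b * (2 * (2 ^+ j * beta)).
  apply: le_trans Ob _; rewrite ler_peMr ?(ltW b_gt0) //; move: pb beta_ge; lra.
rewrite /potential /budget -/beta.
have := ler_wpM2l (ltW b_gt0) ln_le.
by lra.
Qed.

Lemma residual_le_O F e : residual c F (d^~ e) <= O.
Proof. exact: (res_le_O c_ge0 d_ge0 phi_in cost_le_O). Qed.

Lemma account_low T st (U : {set 'I_n}) e a : consistent st -> guess st < O ->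
  residual c (bought st) (d^~ e) + account T (advance st (d^~ e, a)) (U :\ e)
  <= account T st U.
Proof.
move=> [b_ge0 /andP[G_ge0 G_le] t_lt _] b_lt.
have k_ge0 := residual_ge0 c (bought st) (d^~ e).
have k_le := residual_le_O (bought st) e.
set k := residual c _ _ in k_ge0 k_le *.
have L_ge1 := budget_ge1 (level st).
rewrite /account /charge [O <= guess st]leNgt b_lt /=.
rewrite /advance -/k /=; set L := budget _ in L_ge1 G_le *.
have bL : guess st * L <= O * L by rewrite ler_wpM2r ?(ltW b_lt) // (le_trans _ L_ge1).
have OL : O <= O * L by rewrite ler_peMr // ltW.
case: ifPn => [_|_].
  by rewrite /= budgetS -/L [O <= 0]leNgt O_gt0 /=; lra.
case: ifPn => [b_lt_k|].
  rewrite /= -/L; set b' := Num.max _ _.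
  have b'_ge : 2 * guess st <= b' by rewrite le_max lexx.
  have b'_gek : k <= b' by rewrite le_max lexx orbT.
  case: ifPn => [Ob'|].
    (* The new guess overshoots [O] at most twofold, so the fresh charge is at most [4 * O * L]. *)
    have b'_le : b' <= 2 * O by rewrite ge_max; apply/andP; split; lra.
    have := @fresh_potential_le (bought st :|: a.1) b' (U :\ e)
       (rounds (State (clock st).+1 (level st) (bought st :|: a.1) b' 0 (fun=> 0)) (U :\ e))
       (level st) Ob'.
    rewrite /rounds /= => /(_ (leq_trans (geq_minl _ _) (leq_subr _ _))).
    have := ler_wpM2r (le_trans ler01 L_ge1) b'_le; rewrite -/L; lra.
  rewrite -ltNge => b'_lt.
  have : guess st * L <= (b' - guess st) * L by rewrite ler_wpM2r ?(le_trans _ L_ge1) //; lra.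
  by lra.
rewrite -leNgt => k_le_b; case: ifPn => [_|].
  rewrite /= -/L; case: ifPn => [Ob'|].
    have := @fresh_potential_le (bought st :|: a.1) (2 * guess st) (U :\ e)
       (rounds (State (clock st).+1 (level st) (bought st :|: a.1) (2 * guess st) 0 (fun=> 0)) (U :\ e))
       (level st) Ob'.
    rewrite /rounds /= => /(_ (leq_trans (geq_minl _ _) (leq_subr _ _))).
    by rewrite -/L; lra.
  by rewrite -ltNge => b'_lt; lra.
by rewrite -leNgt => _ /=; rewrite -/L [O <= guess st]leNgt b_lt /=; lra.
Qed.

(** Of the two residuals on the right, one is paid now and the other is stored in [spent]; this is
    why [charge] doubles the potential. When a phase or level ends, the old potential is dropped,
    being nonnegative. *)
Lemma account_high T st (U : {set 'I_n}) e a : consistent st -> O <= guess st -> e \in U ->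
  residual c (bought st) (d^~ e) + account T (advance st (d^~ e, a)) (U :\ e)
  <= T - 32 * O * budget (level st) + spent st +
     2 * (residual c (bought st) (d^~ e) +
       pot (bought st :|: a.1) (boost c (guess st) (bought st) (score st) (d^~ e))
         (guess st) (U :\ e) (rounds st U).-1).
Proof.
move=> [b_ge0 /andP[G_ge0 G_le] t_lt _] b_ge eU.
have b_gt0 : 0 < guess st := lt_le_trans O_gt0 b_ge.
have k_ge0 := residual_ge0 c (bought st) (d^~ e).
have k_le := residual_le_O (bought st) e.
set k := residual c _ _ in k_ge0 k_le *.
have L_ge1 := budget_ge1 (level st).
set next := pot _ _ _ _ _.
have next_ge0 : 0 <= next by apply: potential_ge0.
rewrite /account /charge /advance -/k /=; set L := budget _ in L_ge1 G_le *.
case: ifPn => [_|t_lt'].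
  by rewrite /= budgetS -/L [O <= 0]leNgt O_gt0 /=; lra.
case: ifPn => [|_]; first by rewrite ltNge (le_trans k_le b_ge).
case: ifPn => [over|_].
  rewrite /= -/L ifT; last by move: b_ge b_gt0; lra.
  have Ob' : O <= 2 * guess st by lra.
  have := @fresh_potential_le (bought st :|: a.1) (2 * guess st) (U :\ e)
     (rounds (State (clock st).+1 (level st) (bought st :|: a.1) (2 * guess st) 0 (fun=> 0)) (U :\ e))
     (level st) Ob'.
  rewrite /rounds /= => /(_ (leq_trans (geq_minl _ _) (leq_subr _ _))).
  by rewrite -/L; lra.
rewrite /= b_ge -/L.
have -> : rounds (State (clock st).+1 (level st) (bought st :|: a.1) (guess st)
     (spent st + k) (boost c (guess st) (bought st) (score st) (d^~ e))) (U :\ e)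
   = (rounds st U).-1.
  rewrite /rounds /= (cardsD1 e U) eU subnS.
  by case: (_ - _)%N => [|k']; rewrite ?min0n // minnSS.
by rewrite -/next; lra.
Qed.

Lemma account_drift T st (U : {set 'I_n}) : consistent st -> (0 < #|U|)%N ->
  \sum_(e in U) \sum_A
     sample_prob (open_prob c (bought st) (score st) (d^~ e)) A *
       (residual c (bought st) (d^~ e) +
        account T (advance st (d^~ e, decide c (bought st) (d^~ e) A)) (U :\ e))
  <= #|U|%:R * account T st U.
Proof.
move=> st_ok U_gt0.
pose P e := sample_prob (open_prob c (bought st) (score st) (d^~ e)).
have P_ge0 e A : 0 <= P e A by apply: sample_prob_ge0 => i; apply: open_prob01.
have P_cst e y : \sum_A P e A * y = y.
  by rewrite -mulr_suml /P sum_sample_prob mul1r.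
have [Ob|bO] := leP O (guess st); last first.
  rewrite mulr_natl -sumr_const; apply: ler_sum => e eU.
  rewrite -[leRHS](P_cst e); apply: ler_sum => A _; apply: (ler_wpM2l (P_ge0 e A)).
  exact: account_low.
have rP : (0 < rounds st U <= #|U|)%N.
  by rewrite /rounds geq_minr andbT leq_min U_gt0 subn_gt0 andbT; have [] := st_ok.
have := potential_drift c_ge0 d_ge0 phi_in cost_le_O O_gt0 (bought st) (score st) Ob rP.
set S := \sum_(e in U) _ => S_le.
apply: (@le_trans _ _ (#|U|%:R * (T - 32 * O * budget (level st) + spent st) + 2 * S)).
  rewrite mulr_natl -sumr_const /S mulr_sumr -big_split /=; apply: ler_sum => e eU.
  rewrite -[X in _ <= X + _](P_cst e) mulr_sumr -big_split /=; apply: ler_sum => A _.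
  rewrite [X in _ <= _ + X]mulrCA -(mulrDr (P e A)); apply: (ler_wpM2l (P_ge0 e A)).
  exact: (account_high T (decide c (bought st) (d^~ e) A) st_ok Ob eU).
by rewrite /account /charge Ob; move: S_le; lra.
Qed.

Lemma account_set0_ge0 T st : consistent st ->
  32 * O * budget (level st) <= T -> 0 <= account T st finset.set0.
Proof.
move=> [b_ge0 /andP[G_ge0 G_le] _ _] T_ge; rewrite /account addr_ge0 ?subr_ge0 // /charge.
have L_ge1 := budget_ge1 (level st); set L := budget _ in L_ge1 G_le *.
case: ifPn => [Ob|].
  by rewrite addr_ge0 // mulr_ge0 // potential_ge0 // (lt_le_trans O_gt0).
rewrite -ltNge => bO.
have : guess st * L <= O * L by rewrite ler_wpM2r ?(ltW bO) // (le_trans _ L_ge1).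
have : O <= O * L by rewrite ler_peMr // ltW.
by lra.
Qed.

(** A level [j.+1] is reached only if [horizon j <= n], and its budget is [48 * ln (horizon j)]. At
    level 0, [m.+2] is at most the square of [m.+1 * n]. *)
Lemma budget_level_le st : (2 <= m.+1 * n)%N -> consistent st -> clock st = n ->
  budget (level st) <= 48 * ln (m.+1 * n)%N%:R.
Proof.
move=> mn [_ _ _ +] tn; rewrite tn /budget.
have n_gt0 : (0 < n)%N by case: (n) mn => //; rewrite muln0.
case: (level st) => [_|j /(_ _ erefl) Hn].
  have : ln m.+2%:R <= 2 * ln (m.+1 * n)%N%:R :> R.
    rewrite mulr_natl -lnXn ?ltr0n ?muln_gt0 // -natrX ler_ln ?posrE ?ltr0n ?expn_gt0 ?muln_gt0 ?n_gt0 //.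
    by rewrite ler_nat; case: (m) mn => [|m'] mn; nia.
  by rewrite expr0; lra.
have : ln (horizon j)%:R <= ln (m.+1 * n)%N%:R :> R.
  rewrite ler_ln ?posrE ?ltr0n ?muln_gt0 ?(leq_trans _ (horizon_ge2 j)) // ler_nat.
  by apply: leq_trans Hn _; rewrite leq_pmull.
by rewrite ln_horizon exprS; lra.
Qed.

Lemma expected_cost_learn_or_open : (2 <= m.+1 * n)%N ->
  expected_cost learn_or_open c d <= 3072 * ln (m.+1 * n)%N%:R * O.
Proof.
(* Here 1536 is 32 times the 48 of [budget_level_le], keeping the final account nonnegative; [W]
   doubles the account because a step costs at most two residuals in expectation. *)
move=> mn; set T := 1536 * O * ln (m.+1 * n)%N%:R.
apply: le_trans (expected_cost_le c_ge0 d_ge0 valid_learn_or_open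
  (W := fun h U => 2 * account T (run h) U) _ _) _.
- move=> h U _ U_gt0.
  rewrite mulrCA.
  apply: le_trans (ler_wpM2l (ler0n R 2) (account_drift T (consistent_run h) U_gt0)).
  rewrite mulr_sumr; apply: ler_sum => e eU.
  rewrite /learn_or_open (expect_answer c _ _ _ (fun a =>
    step_cost c d (opened h) (e, a) + 2 * account T (run (rcons h (d^~ e, a))) (U :\ e))).
  have split_sum (p f g : {set 'I_m.+1} -> R) :
      \sum_A p A * (f A + g A) = \sum_A p A * f A + \sum_A p A * g A.
    by rewrite -big_split; apply: eq_bigr => A _; rewrite mulrDr.
  rewrite [leLHS]split_sum [X in _ <= _ * X]split_sum mulrDr lerD //; last first.
    by rewrite mulr_sumr; apply: ler_sum => A _; rewrite run_rcons mulrCA.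
  rewrite -bought_run -mulr_suml sum_sample_prob mul1r.
  exact: expected_step_cost_le.
- move=> h hn; rewrite mulr_ge0 // account_set0_ge0 //; first exact: consistent_run.
  have := budget_level_le mn (consistent_run h); rewrite clock_run => /(_ hn).
  by move=> /(ler_wpM2l (ltW O_gt0)); rewrite /T; lra.
rewrite /account /charge /= [O <= 0]leNgt O_gt0 /=.
have := mulr_ge0 (ltW O_gt0) (le_trans ler01 (budget_ge1 0)).
by rewrite /T; lra.
Qed.

End Accounting.
End Algorithm.

Theorem theorem5p3 (R : realType) :
  exists (C : R) (A : forall m : nat, ('I_m -> R) -> policy R m),
  forall (m : nat) (c : 'I_m -> R),
    (0 < m)%N -> (forall i, 0 <= c i) ->
    valid_policy (A m c) /\
    forall (n : nat) (d : 'I_m -> 'I_n -> R),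
      (forall i e, 0 <= d i e) -> (2 <= m * n)%N ->
      expected_cost (A m c) c d <= C * ln (m * n)%N%:R * opt c d.
Proof.
exists 3072, (fun m => if m is m'.+1 return ('I_m -> R) -> policy R m
  then @learn_or_open R m' else fun _ _ _ _ => 0).
case=> // m c _ c_ge0; split=> [|n d d_ge0 mn]; first exact: valid_learn_or_open.
have lnC_gt0 : 0 < 3072 * ln (m.+1 * n)%N%:R :> R.
  by rewrite mulr_gt0 // ln_gt0 // ltr1n.
have cost_ge0 s : 0 <= cost c d s by rewrite addr_ge0 // sumr_ge0.
have feas : (cost c d @` [set s | feasible s] !=set0)%classic.
  exists (cost c d ([set: 'I_m.+1], [ffun=> ord0])), ([set: 'I_m.+1], [ffun=> ord0]) => //=.
  by apply/forallP => e; rewrite inE.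
have opt_ge0 : 0 <= opt c d by apply: lb_le_inf => // _ [s _ <-].
(* A solution of cost below [opt c d + eps] is the comparison, with [O = opt c d + eps], positive
   even when the optimum is 0. *)
rewrite -ler_pdivrMl //; apply/ler_addgt0Pr => eps eps_gt0.
have [_ [[F phi] /forallP /= phi_in <-] lt_opt] : exists2 y,
    (cost c d @` [set s | feasible s])%classic y & y < opt c d + eps.
  by apply: inf_lt => //; rewrite ltrDl.
rewrite ler_pdivrMl //; apply: (expected_cost_learn_or_open c_ge0 d_ge0 phi_in (ltW lt_opt)) => //.
by rewrite ltr_wpDl.
Qed.
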